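(* Let $\eta$ be a fault and let $\hat{\mathcal Z}_{\mathrm A}^\eta\subset\mathbb C\cong\mathbb R^2$ be the zonogon relaxation defined in the context. Suppose $\Lambda$ is a zonotope with center $c$ and generators $g_i$, $i=1,\dots,p$. Let $$c_{\mathrm F}=\xi^\eta+\Xi^\eta\Theta^\eta\left(u^\circ+\Sigma c\right).$$ Then $\hat{\mathcal Z}_{\mathrm A}^\eta$ is a zonogon with center $$\frac{(1+\underline m_z)z+c_{\mathrm F}}{2}$$ and generators $$\frac{(1-\underline m_z)z}{2},\qquad \frac{c_{\mathrm F}}{2},\qquad \Xi^\eta\Theta^\eta\Sigma g_i,\quad i=1,\dots,p.$$
   Context: Sets in $\mathbb C$ are viewed as subsets of $\mathbb R^2$ (convexity is over the reals). For sets $\mathcal X,\mathcal Y$ and a scalar $\alpha$: $\alpha\mathcal X=\{\alpha x:x\in\mathcal X\}$ and $\mathcal X\oplus\mathcal Y=\{x+y:x\in\mathcal X,y\in\mathcal Y\}$. A zonotope in a finite-dimensional real vector space with center $c$ and generators $g_1,\dots,g_p$ is the set $\{c+\sum_{i=1}^p\beta_i g_i:\beta\in[-1,1]^p\}$. A zonogon is a zonotope in the plane (possibly degenerate). Data. $z\in\mathbb C$ is the line impedance, $k\in\mathbb C$ the zero-sequence compensation factor, $r_{\mathrm F}>0$, $\underline m_z\in[0,1)$. The measured local current $i_{\mathrm L}=(i_{\mathrm L}^{\mathrm a},i_{\mathrm L}^{\mathrm b},i_{\mathrm L}^{\mathrm c})\in\mathbb C^3$ is known, with $i_{\mathrm L}^0=\frac13(i_{\mathrm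 L}^{\mathrm a}+i_{\mathrm L}^{\mathrm b}+i_{\mathrm L}^{\mathrm c})$. Let $e^{\mathrm a},e^{\mathrm b},e^{\mathrm c}$ be the standard basis row vectors of length 3. For a line-to-ground fault on phase $p$, set $i_{\mathrm A}^\eta=i_{\mathrm L}^p+k i_{\mathrm L}^0$, $\xi^\eta=r_{\mathrm F}i_{\mathrm L}^p/i_{\mathrm A}^\eta$, $\Xi^\eta=(r_{\mathrm F}/i_{\mathrm A}^\eta)e^p$. For a line-to-line fault between phases $p\ne q$, set $i_{\mathrm A}^\eta=i_{\mathrm L}^p-i_{\mathrm L}^q$, $\xi^\eta=r_{\mathrm F}/2$, $\Xi^\eta=\frac{r_{\mathrm F}}{2i_{\mathrm A}^\eta}(e^p-e^q)$. In all cases $i_{\mathrm A}^\eta\neq0$ is assumed. All other fault types are modelled by one of these two kinds of fault loop. Sources. $u^\circ\in\mathbb C^N$ is the vector of nominal sources (IBR currents $i^\circ_{\mathcal C}$ stacked on SG voltages $v^\circ_{\mathcal S}$), $\Sigma\in\mathbb C^{N\times q}$ is a scaling matrix, $\Lambda\subset\mathbb R^q$ is the noise set (complex noise is split into real and imaginary parts), and $\mathcal U=\{u^\circ+\Sigma\lambda:\lambda\in\Lambda\}$. $\Theta^\eta\in\mathbb C^{3\times N}$ is a fixed matrix giving the remote current $i_{\mathrm R}=\Theta^\eta u$ in scenario $\eta$, and $\mathcal I_{\mathrm R}^\eta=\{\Theta^\eta u:u\in\mathcal U\}$. Relaxation. $\mathcal Z_{\mathrm T}=\{m_z z:m_z\in[\underline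 m_z,1]\}$. The fault-current set $\mathcal I_{\mathrm F}^\eta\subset\mathbb C$ is defined by $\frac{r_{\mathrm F}}{i_{\mathrm A}^\eta}\mathcal I_{\mathrm F}^\eta=\{\xi^\eta+\Xi^\eta i_{\mathrm R}: i_{\mathrm R}\in\mathcal I_{\mathrm R}^\eta\}$; its center is the value of $i_{\mathrm F}$ obtained at $\lambda=c$. Let $\hat{\mathcal I}_{\mathrm F}^\eta$ be the translate of $\mathcal I_{\mathrm F}^\eta$ whose center is $0$, let $\hat{\mathcal Z}_{\mathrm F}^\eta$ be the convex hull of $\frac{r_{\mathrm F}}{i_{\mathrm A}^\eta}(\mathcal I_{\mathrm F}^\eta\cup\hat{\mathcal I}_{\mathrm F}^\eta)$, and $\hat{\mathcal Z}_{\mathrm A}^\eta=\mathcal Z_{\mathrm T}\oplus\hat{\mathcal Z}_{\mathrm F}^\eta$. *)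

(* Defs.v *)
From HB Require Import structures.
From mathcomp Require Import all_boot all_order all_algebra.
From mathcomp Require Import all_classical all_reals convex.
From mathcomp.real_closed Require Import complex.

Set Implicit Arguments.
Unset Strict Implicit.
Unset Printing Implicit Defensive.

Import Order.TTheory GRing.Theory Num.Theory.
Local Open Scope classical_set_scope.
Local Open Scope ring_scope.
Local Open Scope complex_scope.

Definition zonotope (R : realType) (V : lmodType R) (c : V) (gs : seq V)
    : set V :=
  [set x | exists2 beta : 'I_(size gs) -> R,
     (forall i, -1 <= beta i <= 1)
     & x = c + \sum_(i < size gs) beta i *: gs`_i].

(* [R[i]] is a vector space over itself; its alias [Rcomplex R] is the one    *)
(* carrying the scaling by real numbers, i.e. it is the real plane.           *)
Definition zonogon (R : realType) (c : R[i]) (gs : seq R[i]) : set R[i] :=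
  @zonotope R (Rcomplex R) c gs.

Definition convex_hull (R : realType) (A : set R[i]) : set R[i] :=
  smallest (@convex_set R (Rcomplex R)) A.

Definition scale_set (R : realType) (a : R[i]) (X : set R[i]) : set R[i] :=
  [set a * x | x in X].

Definition minkowski_sum (R : realType) (X Y : set R[i]) : set R[i] :=
  [set x + y | x in X & y in Y].

Definition complex_mx (R : realType) (m n : nat) (A : 'M[R]_(m, n))
    : 'M[R[i]]_(m, n) :=
  map_mx (real_complex R) A.

(* The phases a, b, c are the indices 0, 1, 2. *)
Inductive fault_loop : Type :=
| line_to_ground (p : 'I_3)
| line_to_line (p q : 'I_3) of p != q.

(* For the fault loop [eta]: [loop_current] is i_A, [loop_offset] is xi,       *)
(* [loop_gain] is Xi, and [fault_impedance iR] is xi + Xi i_R.                 *)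
Section Relaxation.
Variables (R : realType).
Variables (k : R[i]) (rF : R) (iL : 'cV[R[i]]_3) (eta : fault_loop).

Definition zero_sequence : R[i] := (\sum_(p < 3) iL p 0) / 3%:R.

Definition loop_current : R[i] :=
  match eta with
  | line_to_ground p => iL p 0 + k * zero_sequence
  | line_to_line p q _ => iL p 0 - iL q 0
  end.

Definition loop_offset : R[i] :=
  match eta with
  | line_to_ground p => rF%:C * iL p 0 / loop_current
  | line_to_line _ _ _ => rF%:C / 2%:R
  end.

Definition loop_gain : 'rV[R[i]]_3 :=
  match eta with
  | line_to_ground p => (rF%:C / loop_current) *: delta_mx 0 p
  | line_to_line p q _ =>
      (rF%:C / (2%:R * loop_current)) *: (delta_mx 0 p - delta_mx 0 q)
  end.

Definition fault_impedance (iR : 'cV[R[i]]_3) : R[i] :=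
  loop_offset + (loop_gain *m iR) 0 0.

(* The solution i_F of (rF / i_A) i_F = xi + Xi i_R (rF and i_A nonzero). *)
Definition fault_current (iR : 'cV[R[i]]_3) : R[i] :=
  (rF%:C / loop_current)^-1 * fault_impedance iR.

Variables (N q : nat).
Variables (u0 : 'cV[R[i]]_N) (Sigma : 'M[R[i]]_(N, q)).
Variable Theta : 'M[R[i]]_(3, N).

Definition source (lambda : 'cV[R]_q) : 'cV[R[i]]_N :=
  u0 + Sigma *m complex_mx lambda.

Definition source_set (Lambda : set 'cV[R]_q) : set 'cV[R[i]]_N :=
  [set source lambda | lambda in Lambda].

Definition remote_current_set (Lambda : set 'cV[R]_q) : set 'cV[R[i]]_3 :=
  [set Theta *m u | u in source_set Lambda].

Definition fault_current_set (Lambda : set 'cV[R]_q) : set R[i] :=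
  [set fault_current iR | iR in remote_current_set Lambda].

Lemma fault_current_setE (Lambda : set 'cV[R]_q) :
  0 < rF -> loop_current != 0 ->
  scale_set (rF%:C / loop_current) (fault_current_set Lambda)
  = [set fault_impedance iR | iR in remote_current_set Lambda].
Proof.
move=> rF0 iA0; rewrite /scale_set /fault_current_set image_comp.
apply: eq_imagel => iR _ /=; rewrite /fault_current mulrA divff ?mul1r//.
rewrite mulf_neq0 ?invr_eq0//.
by rewrite eq_complex /= eqxx andbT gt_eqF.
Qed.

(* In what follows [c] is the center of the zonotope [Lambda]. *)
Definition fault_current_center (c : 'cV[R]_q) : R[i] :=
  fault_current (Theta *m source c).

Definition centered_fault_current_set (Lambda : set 'cV[R]_q) (c : 'cV[R]_q)
    : set R[i] :=
  [set i - fault_current_center c | i in fault_current_set Lambda].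

Definition fault_impedance_relaxation (Lambda : set 'cV[R]_q) (c : 'cV[R]_q)
    : set R[i] :=
  convex_hull (scale_set (rF%:C / loop_current)
    (fault_current_set Lambda `|` centered_fault_current_set Lambda c)).

Definition line_impedance_set (z : R[i]) (mz : R) : set R[i] :=
  [set m%:C * z | m in `[mz, 1]].

Definition apparent_impedance_relaxation (z : R[i]) (mz : R)
    (Lambda : set 'cV[R]_q) (c : 'cV[R]_q) : set R[i] :=
  minkowski_sum (line_impedance_set z mz) (fault_impedance_relaxation Lambda c).

End Relaxation.

(* Main.v *)
Require Import Defs.
From HB Require Import structures.
From mathcomp Require Import all_boot all_order all_algebra.
From mathcomp Require Import all_classical all_reals convex.
From mathcomp.real_closed Require Import complex.
From mathcomp Require Import ring lra interval_inference.

(** Affine maps send zonotopes to zonotopes, and [lambda |-> xi + Xi Theta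
    (u0 + Sigma lambda)] is real-affine.  So when [Lambda] is a zonotope, the
    scaled fault-current set is a zonotope [Z] centered at [cF], whose
    generators are the images of those of [Lambda] under the linear part
    ([fault_impedance_set_zonogon]).  The scaled centered set is the translate
    [Z - cF].  The convex hull of two translates [Z0 + h] and [Z0 - h] of a
    zonotope [Z0] is swept by the translates [Z0 + b h] with [-1 <= b <= 1],
    which amounts to adding the generator [h] to [Z0]
    ([convex_hull_zonotope_translates]); here [h = cF / 2], and [Z0] is
    centered at [cF / 2].  Finally the segment [ [mz, 1] z ] is itself a
    zonotope with one generator ([line_impedance_set_zonogon]), and Minkowski
    sums of zonotopes add the centers and concatenate the generators
    ([minkowski_sum_zonogon]). *)

Set Implicit Arguments.
Unset Strict Implicit.
Unset Printing Implicit Defensive.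

Import Order.TTheory GRing.Theory Num.Theory.
Local Open Scope classical_set_scope.
Local Open Scope ring_scope.
Local Open Scope complex_scope.

(** * Zonotopes in real vector spaces *)

Section Zonotope.
Variables (R : realType) (V : lmodType R).
Implicit Types (c d h x : V) (gs : seq V).

Lemma zonotope_nil c x : zonotope c [::] x <-> x = c.
Proof.
split=> [[b _ ->]|->]; first by rewrite big_ord0 addr0.
by exists (fun=> 0) => [[]//|]; rewrite big_ord0 addr0.
Qed.

(** Peeling off one generator lets zonotopes be handled by induction on the
    list of generators, with no reindexing of coefficient families. *)
Lemma zonotope_cons c h gs x :
  zonotope c (h :: gs) x <->
  exists2 b : R, -1 <= b <= 1 & zonotope (c + b *: h) gs x.
Proof.
split=> [[beta betaP ->]|[b bP [beta betaP ->]]].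
  exists (beta ord0) => //; exists (fun i => beta (lift ord0 i)) => //.
  by rewrite big_ord_recl addrA.
exists (fun i : 'I_(size gs).+1 => oapp beta b (unlift ord0 i)).
  by move=> i; case: unliftP => [j|] _ /=.
rewrite big_ord_recl /= unlift_none /= addrA; congr (_ + _).
by apply: eq_bigr => i _; rewrite liftK.
Qed.

Lemma zonotope_translate d c gs x :
  zonotope c gs x -> zonotope (c + d) gs (x + d).
Proof. by case=> beta betaP ->; exists beta => //; rewrite addrAC. Qed.

Lemma image_translate_zonotope d c gs :
  [set x + d | x in zonotope c gs] = zonotope (c + d) gs.
Proof.
apply/seteqP; split=> [_ [x cx <-]|x cx]; first exact: zonotope_translate.
exists (x - d); last by rewrite subrK.
by move: cx => /(zonotope_translate (- d)); rewrite addrK.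
Qed.

Lemma convex_setE (A : set V) :
  convex_set A <-> forall x y (t : R), 0 <= t <= 1 -> A x -> A y ->
    A (t *: x + (1 - t) *: y).
Proof.
split=> [Acvx x y t /andP[t0 t1] Ax Ay|Acvx x y t].
  by move: (Acvx x y (Itv01 t0 t1)); rewrite !inE; apply.
rewrite !inE => Ax Ay; apply: (Acvx _ _ t%:num) => //.
by apply/andP; split.
Qed.

Lemma convex_zonotope c gs : convex_set (zonotope c gs).
Proof.
apply/convex_setE => x y t /andP[t0 t1].
move=> [a aP ->] [b bP ->].
exists (fun i => t * a i + (1 - t) * b i).
  move=> i; move: (aP i) (bP i) => /andP[? ?] /andP[? ?].
  by apply/andP; split; nra.
rewrite !scalerDr addrACA -scalerDl (addrC t) subrK scale1r.
rewrite !scaler_sumr -big_split; congr (c + _).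
by apply: eq_bigr => i _; rewrite /= !scalerA scalerDl.
Qed.

(** A point of the zonotope with coefficient [b] along [h] lies on the segment
    parallel to [h] whose ends have coefficients [1] and [-1] along [h] and the
    same other coefficients, at ratio [(1 + b) / 2]. *)
Lemma convex_hull_zonotope_translates c h gs :
  smallest (@convex_set R V) (zonotope (c + h) gs `|` zonotope (c - h) gs)
  = zonotope c (h :: gs).
Proof.
apply/seteqP; split.
  apply: smallest_sub; first exact: convex_zonotope.
  move=> x [hx|hx]; apply/zonotope_cons.
    by exists 1; rewrite ?scale1r//; apply/andP; split; lra.
  by exists (-1); rewrite ?scaleN1r//; apply/andP; split; lra.
move=> x /zonotope_cons[b /andP[b0 b1] hx] A [/convex_setE Acvx sub].
pose t := (1 + b) / 2.
have -> : x = t *: (x + (1 - b) *: h) + (1 - t) *: (x + (- 1 - b) *: h).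
  rewrite !scalerDr !scalerA addrACA -!scalerDl.
  have -> : t + (1 - t) = 1 by ring.
  have -> : t * (1 - b) + (1 - t) * (- 1 - b) = 0 by rewrite /t; field.
  by rewrite scale1r scale0r addr0.
have shift (e : R) : c + b *: h + (e - b) *: h = c + e *: h.
  by rewrite -addrA -scalerDl (addrC b) subrK.
apply: Acvx; first by rewrite /t; apply/andP; split; lra.
- apply: sub; left; have := zonotope_translate ((1 - b) *: h) hx.
  by rewrite shift scale1r.
- apply: sub; right; have := zonotope_translate ((- 1 - b) *: h) hx.
  by rewrite shift scaleN1r.
Qed.

End Zonotope.

(** Linearity is a hypothesis on a bare function so that the lemma can be used
    directly on a map into the plane, for its structure of real vector space. *)
Lemma image_linear_zonotope (R : realType) (V W : lmodType R) (L : V -> W)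
    (linL : linear L) (c : V) (gs : seq V) :
  [set L x | x in zonotope c gs] = zonotope (L c) (map L gs).
Proof.
pose HL := GRing.isLinear.Build R V W *:%R L linL.
pose L' : {linear V -> W} := HB.pack L HL.
have LD x y : L (x + y) = L x + L y by exact: (raddfD L').
have LZ a x : L (a *: x) = a *: L x by exact: (linearZZ L').
elim: gs c => [|g gs IH] c.
  apply/seteqP; split=> [_ [x /zonotope_nil -> <-]|x /zonotope_nil ->].
    exact/zonotope_nil.
  by exists c => //; exact/zonotope_nil.
apply/seteqP; split=> [_ [x /zonotope_cons[b bP cx] <-]|x].
  apply/zonotope_cons; exists b => //.
  by rewrite -LZ -LD -IH; exists x.
move=> /zonotope_cons[b bP]; rewrite -LZ -LD -IH => -[y cy <-].
by exists y => //; apply/zonotope_cons; exists b.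
Qed.

(** * Zonogons in the complex plane *)

Section Zonogon.
Variable R : realType.
Implicit Types (c d x z : R[i]) (gs hs : seq R[i]).

Lemma Rcomplex_scaleE (b : R) x : b *: (x : Rcomplex R) = b%:C * x.
Proof. by case: x => u v; simpc. Qed.

Lemma minkowski_sum_zonogon c d gs hs :
  minkowski_sum (zonogon c gs) (zonogon d hs) = zonogon (c + d) (gs ++ hs).
Proof.
elim: gs c => [|g gs IH] c.
  rewrite cat0s addrC -[RHS](@image_translate_zonotope R (Rcomplex R)).
  apply/seteqP; split=> [_ [_ /zonotope_nil -> [y dy <-]]|_ [y dy <-]].
    by exists y => //; rewrite addrC.
  exists c; first exact/zonotope_nil.
  by exists y => //; rewrite addrC.
have shift b : (c + b%:C * g) + d = (c + d) + b%:C * g by ring.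
apply/seteqP; split=> [_ [x /zonotope_cons[b bP cx] [y dy <-]]|x].
  apply/zonotope_cons; exists b => //.
  rewrite Rcomplex_scaleE -shift -[zonotope _ _]/(zonogon _ _) -IH.
  by exists x; [rewrite -Rcomplex_scaleE | exists y].
move=> /zonotope_cons[b bP].
rewrite Rcomplex_scaleE -shift -[zonotope _ _]/(zonogon _ _) -IH.
move=> [u cu [v dv <-]]; exists u; last by exists v.
by apply/zonotope_cons; exists b => //; rewrite Rcomplex_scaleE.
Qed.

Lemma line_impedance_set_zonogon z (mz : R) : mz < 1 ->
  line_impedance_set z mz
  = zonogon ((1 + mz%:C) * z / 2%:R) [:: (1 - mz%:C) * z / 2%:R].
Proof.
move=> mz1; have d_gt0 : 0 < 1 - mz by rewrite subr_gt0.
(* the affine bijection from [-1, 1] onto [mz, 1] sends the coefficient [b] to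
   the multiplier [m = ((1 + mz) + b (1 - mz)) / 2] *)
have coefE (b : R) : (1 + mz%:C) * z / 2%:R + b%:C * ((1 - mz%:C) * z / 2%:R)
    = (((1 + mz) + b * (1 - mz)) / 2)%:C * z.
  by rewrite !rmorphM !rmorphD rmorphM rmorphB /= rmorph1 fmorphV rmorph_nat; field.
apply/seteqP; split=> [_ [m /= + <-]|x].
  rewrite in_itv /= => /andP[m0 m1]; apply/zonotope_cons.
  exists ((2 * m - 1 - mz) / (1 - mz)).
    by rewrite ler_pdivlMr// ler_pdivrMr//; apply/andP; split; lra.
  apply/zonotope_nil; rewrite Rcomplex_scaleE coefE; congr (_%:C * _).
  by field; rewrite gt_eqF.
move=> /zonotope_cons[b /andP[b0 b1] /zonotope_nil ->].
rewrite Rcomplex_scaleE coefE; eexists; last by [].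
by rewrite /= in_itv /=; apply/andP; split; nra.
Qed.

End Zonogon.

(** * The relaxation of the apparent impedance *)

Section FaultImpedance.
Variables (R : realType) (k : R[i]) (rF : R) (iL : 'cV[R[i]]_3).
Variables (eta : fault_loop) (N q : nat) (u0 : 'cV[R[i]]_N).
Variables (Sigma : 'M[R[i]]_(N, q)) (Theta : 'M[R[i]]_(3, N)).

Lemma complex_mx_row_linear (A : 'rV[R[i]]_q) :
  linear (fun lambda : 'cV[R]_q => (A *m complex_mx lambda) 0 0 : Rcomplex R).
Proof.
move=> a x y; rewrite Rcomplex_scaleE /complex_mx map_mxD map_mxZ.
by rewrite mulmxDr -scalemxAr !mxE.
Qed.

Lemma fault_impedance_source (lambda : 'cV[R]_q) :
  fault_impedance k rF iL eta (Theta *m source u0 Sigma lambda)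
  = loop_offset k rF iL eta
    + (loop_gain k rF iL eta *m Theta *m (u0 + Sigma *m complex_mx lambda)) 0 0.
Proof. by rewrite /fault_impedance /source mulmxA. Qed.

Lemma fault_impedance_set_zonogon (c : 'cV[R]_q) (gs : seq 'cV[R]_q) :
  [set fault_impedance k rF iL eta iR
     | iR in remote_current_set u0 Sigma Theta (zonotope c gs)]
  = zonogon (fault_impedance k rF iL eta (Theta *m source u0 Sigma c))
      [seq (loop_gain k rF iL eta *m Theta *m Sigma *m complex_mx gi) 0 0
         | gi <- gs].
Proof.
set A := _ *m _ *m Sigma.
pose d := loop_offset k rF iL eta + (loop_gain k rF iL eta *m Theta *m u0) 0 0.
have affine lambda :
    fault_impedance k rF iL eta (Theta *m source u0 Sigma lambda)
    = (A *m complex_mx lambda) 0 0 + d.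
  by rewrite fault_impedance_source mulmxDr mxE mulmxA addrA addrC.
rewrite affine /zonogon -image_translate_zonotope.
rewrite -(image_linear_zonotope (complex_mx_row_linear A)).
rewrite /remote_current_set /source_set !image_comp.
by apply: eq_imagel => lambda _ /=; rewrite affine.
Qed.

(** Fault currents are defined through division by the factor [rF / iA], so
    scaling back by it recovers the fault impedances; the center, being the
    fault current of one particular source, is scaled the same way. *)
Lemma scaled_fault_currents (Lambda : set 'cV[R]_q) (c : 'cV[R]_q) :
  0 < rF -> loop_current k iL eta != 0 ->
  let Z := [set fault_impedance k rF iL eta iR
              | iR in remote_current_set u0 Sigma Theta Lambda] in
  scale_set (rF%:C / loop_current k iL eta)
    (fault_current_set k rF iL eta u0 Sigma Theta Lambda
     `|` centered_fault_current_set k rF iL eta u0 Sigma Theta Lambda c)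
  = Z `|` [set x - fault_impedance k rF iL eta (Theta *m source u0 Sigma c)
             | x in Z].
Proof.
move=> rF0 iA0 Z; rewrite /scale_set image_setU.
rewrite -[X in X `|` _]/(scale_set _ _) fault_current_setE//; congr (_ `|` _).
rewrite /Z -fault_current_setE// /centered_fault_current_set /scale_set.
rewrite !image_comp; apply: eq_imagel => i _ /=.
have a_neq0 : rF%:C / loop_current k iL eta != 0.
  by rewrite mulf_neq0 ?invr_eq0// eq_complex /= eqxx andbT gt_eqF.
by rewrite mulrBr /fault_current_center /fault_current !mulVKf.
Qed.

End FaultImpedance.

Theorem lemma3 (R : realType) (z k : R[i]) (rF mz : R) (iL : 'cV[R[i]]_3)
    (eta : fault_loop) (N q p : nat) (u0 : 'cV[R[i]]_N)
    (Sigma : 'M[R[i]]_(N, q)) (Theta : 'M[R[i]]_(3, N))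
    (Lambda : set 'cV[R]_q) (c : 'cV[R]_q) (g : p.-tuple 'cV[R]_q)
    (rF_gt0 : 0 < rF) (mz_ge0 : 0 <= mz) (mz_lt1 : mz < 1)
    (iA_neq0 : loop_current k iL eta != 0)
    (Lambda_zonotope : Lambda = zonotope c g) :
  let xi := loop_offset k rF iL eta in
  let Xi := loop_gain k rF iL eta in
  let cF := xi + (Xi *m Theta *m (u0 + Sigma *m complex_mx c)) 0 0 in
  apparent_impedance_relaxation k rF iL eta u0 Sigma Theta z mz Lambda c
  = zonogon (((1 + mz%:C) * z + cF) / 2%:R)
      [:: (1 - mz%:C) * z / 2%:R, cF / 2%:R
        & [seq (Xi *m Theta *m Sigma *m complex_mx gi) 0 0 | gi <- g]].
Proof.
move=> xi Xi cF.
have cFE : fault_impedance k rF iL eta (Theta *m source u0 Sigma c) = cF.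
  exact: fault_impedance_source.
rewrite /apparent_impedance_relaxation line_impedance_set_zonogon//.
rewrite /fault_impedance_relaxation scaled_fault_currents// Lambda_zonotope.
rewrite fault_impedance_set_zonogon cFE.
set gs := map _ g; set l := (1 - mz%:C) * z / 2%:R.
(* the two translates are centered at [cF] and [0], that is [cF/2 + h] and
   [cF/2 - h] with [h = cF/2] *)
have -> : [set x - cF | x in zonogon cF gs] = zonogon (cF / 2%:R - cF / 2%:R) gs.
  rewrite subrr -(subrr cF).
  exact: (@image_translate_zonotope R (Rcomplex R)).
have -> : zonogon cF gs = zonogon (cF / 2%:R + cF / 2%:R) gs.
  by congr (zonogon _ _); field.
rewrite /convex_hull /zonogon (@convex_hull_zonotope_translates R (Rcomplex R)).
rewrite -!/(zonogon _ _) minkowski_sum_zonogon.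
by congr (zonogon _ _); rewrite -mulrDl.
Qed.
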